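(* For every connected, nonempty, abstract MD-graph $G$, there is an alternating word $w\in\mathbb{Z}*\mathbb{Z}$ and an extremal point $f$ of a flow-polyhedron associated to $w$ such that $G$ is (isomorphic to) the abstract graph underlying $f$.
   Context: An MD-graph is a finite multi-digraph (multiple edges and loops allowed). It is nonempty if it has at least one edge. It is connected if for all vertices $i,j$ there is a directed path from $i$ to $j$. Consider the smallest equivalence relation on MD-graphs (up to isomorphism) which is stable under subdivision of directed edges. An MD-graph is abstract if it contains no subdivided edge, i.e. no vertex that has exactly one incoming edge and exactly one outgoing edge with these two edges distinct. Every MD-graph is equivalent to a unique (up to isomorphism) abstract one, called its abstract graph. Let $G_n$ be the complete digraph on $\{1,\dots,n\}$, with edge set $\{1,\dots,n\}^2$ (loops included). A flow on $G_n$ is a map $f:\{1,\dots,n\}^2\to\mathbb{R}_{\geq0}$ with $\sum_jf_{ji}=\sum_jf_{ij}$ for all $i$; write $\operatorname{outflow}_i(f)=\sum_jf_{ij}$, where $f_{ij}$ is the value on the edge from $i$ to $j$. The support of $f$ is the digraph induced by the edges with nonzero flow; the abstract graph underlying $f$ is the abstract graph of the support of $f$. For $z\in(\mathbb{Z}\setminus\{0\})^n$ with $\sum_jz_j=0$, let $V(z)$ be the cone of flows $f$ on $G_n$ with $\sum_jz_j\operatorname{outflow}_j(f)=0$, let $D(z)$ be the set of nonzero integral vectors in $V(z)$ with connected support, and let $P(z)=\operatorname{conv}(D(z)+V(z))$. The flow-polyhedra associated to a word $w=a^{x_1}b^{y_1}\cdots a^{x_n}b^{y_n}\in\mathbb{Z}*\mathbb{Z}$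 (all $x_j,y_j$ nonzero, $\sum_jx_j=\sum_jy_j=0$), where $a,b$ generate the two factors, are $P(x)$ and $P(y)$. The word $w$ is alternating if all exponents $x_j,y_j$ lie in $\{1,-1\}$. A point $d$ of a set $S\subset\mathbb{R}^N$ is an extremal point of $S$ if $d=\sum_i\lambda_iv_i$ (finite sum) with $\lambda_i>0$, $\sum_i\lambda_i=1$, $v_i\in S$ implies $v_i=d$ for all $i$. *)

(* Defs.v *)
From HB Require Import structures.
From mathcomp Require Import all_boot all_order all_algebra all_fingroup.
From mathcomp Require Import classical_sets reals.

Set Implicit Arguments.
Unset Strict Implicit.
Unset Printing Implicit Defensive.

Import Order.TTheory GRing.Theory Num.Theory.
Local Open Scope classical_set_scope.
Local Open Scope ring_scope.

Record mdgraph : Type := MDGraph {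
  md_vertex : finType;
  md_edge : finType;
  md_src : md_edge -> md_vertex;
  md_tgt : md_edge -> md_vertex }.

Definition md_nonempty (G : mdgraph) : Prop := (0 < #|md_edge G|)%N.

Definition md_adj (G : mdgraph) : rel (md_vertex G) :=
  fun u v => [exists e : md_edge G, (md_src e == u) && (md_tgt e == v)].

Definition md_connected (G : mdgraph) : Prop :=
  forall u v : md_vertex G, connect (@md_adj G) u v.

Definition md_iso (G H : mdgraph) : Prop :=
  exists (fv : md_vertex G -> md_vertex H) (fe : md_edge G -> md_edge H),
    [/\ bijective fv, bijective fe,
        forall e, md_src (fe e) = fv (md_src e)
      & forall e, md_tgt (fe e) = fv (md_tgt e)].

(* The edge e : u -> v is replaced by u -> None -> v, where None is a new
   vertex; [Some e] becomes the first half and the edge [None] the second. *)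
Definition md_subdivide (G : mdgraph) (e : md_edge G) : mdgraph :=
  @MDGraph (option (md_vertex G)) (option (md_edge G))
    (fun d => if d is Some d' then Some (md_src d') else None)
    (fun d => if d is Some d' then
                if d' == e then None else Some (md_tgt d')
              else Some (md_tgt e)).

Inductive md_equiv : mdgraph -> mdgraph -> Prop :=
| md_equiv_iso G H : md_iso G H -> md_equiv G H
| md_equiv_subdivide G (e : md_edge G) : md_equiv G (md_subdivide e)
| md_equiv_sym G H : md_equiv G H -> md_equiv H G
| md_equiv_trans G H K : md_equiv G H -> md_equiv H K -> md_equiv G K.

Definition md_subdivision_vertex (G : mdgraph) (v : md_vertex G) : Prop :=
  exists e1 e2 : md_edge G,
    [/\ e1 != e2, forall e, (md_tgt e == v) = (e == e1)
      & forall e, (md_src e == v) = (e == e2)].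

Definition md_abstract (G : mdgraph) : Prop :=
  forall v : md_vertex G, ~ md_subdivision_vertex v.

Definition md_abstract_graph_of (H G : mdgraph) : Prop :=
  md_abstract G /\ md_equiv H G.

(* Flows on the complete digraph with loops on 'I_n: the entry f i j is the
   value on the edge from i to j. *)

Section Flows.
Variables (R : realType) (n : nat).
Implicit Types (f : 'M[R]_n) (z : 'I_n -> int).

Definition outflow f (i : 'I_n) : R := \sum_(j < n) f i j.

Definition is_flow f : Prop :=
  (forall i j, 0 <= f i j) /\
  (forall i, \sum_(j < n) f j i = \sum_(j < n) f i j).

Definition supp_vertex f : pred 'I_n :=
  fun i => [exists j, (f i j != 0) || (f j i != 0)].

Definition supp_edge f : pred ('I_n * 'I_n) := fun e => f e.1 e.2 != 0.

Fact supp_src_subproof f (e : {e | supp_edge f e}) : supp_vertex f (val e).1.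
Proof.
by apply/existsP; exists (val e).2; have := valP e; rewrite /supp_edge => ->.
Qed.

Fact supp_tgt_subproof f (e : {e | supp_edge f e}) : supp_vertex f (val e).2.
Proof.
apply/existsP; exists (val e).1; have := valP e; rewrite /supp_edge => ->.
by rewrite orbT.
Qed.

Definition flow_support f : mdgraph :=
  @MDGraph {i | supp_vertex f i} {e | supp_edge f e}
    (fun e => Sub (val e).1 (supp_src_subproof e))
    (fun e => Sub (val e).2 (supp_tgt_subproof e)).

Definition flow_cone z : set 'M[R]_n :=
  [set f | is_flow f /\ \sum_(j < n) (z j)%:~R * outflow f j = 0].

Definition disk_vectors z : set 'M[R]_n :=
  [set f | [/\ flow_cone z f, f != 0, forall i j, f i j \is a Num.int
             & md_connected (flow_support f)]].

End Flows.

Definition convex_hull (R : realType) (V : lmodType R) (S : set V) : set V :=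
  [set v | exists (k : nat) (l : 'I_k -> R) (p : 'I_k -> V),
     [/\ forall i, 0 <= l i, \sum_(i < k) l i = 1, forall i, S (p i)
       & v = \sum_(i < k) l i *: p i]].

Definition extremal_point (R : realType) (V : lmodType R) (S : set V) (d : V) :
    Prop :=
  S d /\
  forall (k : nat) (l : 'I_k -> R) (v : 'I_k -> V),
    (forall i, 0 < l i) -> \sum_(i < k) l i = 1 -> (forall i, S (v i)) ->
    d = \sum_(i < k) l i *: v i -> forall i, v i = d.

Definition flow_polyhedron (R : realType) (n : nat) (z : 'I_n -> int) :
    set 'M[R]_n :=
  convex_hull [set d + v | d in disk_vectors z & v in flow_cone z].

(* The free product Z * Z, as the group of reduced words. A syllable (s, k) is
   the k-th power of the generator of the factor s; in a reduced word the
   exponents are nonzero and consecutive syllables lie in different factors. *)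

Definition reduced_word (s : seq (bool * int)) : bool :=
  all (fun c => c.2 != 0) s && sorted (fun c d => c.1 != d.1) s.

Record freeZZ : Type := FreeZZ {
  syllables :> seq (bool * int);
  _ : reduced_word syllables }.

HB.instance Definition _ := [isSub for syllables].
HB.instance Definition _ := [Choice of freeZZ by <:].

Definition lmul_syllable (c : bool * int) (s : seq (bool * int)) :=
  if c.2 == 0 then s
  else if s is d :: s' then
    if c.1 == d.1 then
      if c.2 + d.2 == 0 then s' else (c.1, c.2 + d.2) :: s'
    else c :: s
  else [:: c].

Definition word_mul (u v : seq (bool * int)) := foldr lmul_syllable v u.

Definition word_inv (u : seq (bool * int)) := rev [seq (c.1, - c.2) | c <- u].

Lemma reduced_word_cons c s :
  reduced_word (c :: s) =
  [&& c.2 != 0, (if s is d :: _ then c.1 != d.1 else true) & reduced_word s].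
Proof.
rewrite /reduced_word /=; case: s => [|d s] /=; first by rewrite !andbT.
by case: (c.2 != 0); case: (d.2 != 0); case: (c.1 != d.1); rewrite ?andbF.
Qed.

Lemma lmul_syllable_reduced c s :
  reduced_word s -> reduced_word (lmul_syllable c s).
Proof.
rewrite /lmul_syllable; case: eqVneq => // c0.
case: s => [|d s]; first by rewrite reduced_word_cons c0.
move=> rds; case: eqVneq => [ecd|ncd]; last by rewrite reduced_word_cons c0 ncd.
move: rds; rewrite reduced_word_cons => /and3P[d0 ds rs].
case: eqVneq => // cd0; rewrite reduced_word_cons cd0 rs /=.
by case: s ds {rs} => //= e s; rewrite ecd => ->.
Qed.

Lemma lmul_syllable_cons c s :
  reduced_word (c :: s) -> lmul_syllable c s = c :: s.
Proof.
rewrite reduced_word_cons /lmul_syllable => /and3P[/negPf -> + _].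
by case: s => // d s /negPf ->.
Qed.

Lemma lmul_syllableD t k l s : reduced_word s ->
  lmul_syllable (t, k) (lmul_syllable (t, l) s) = lmul_syllable (t, k + l) s.
Proof.
move=> rs; have [->|k0] := eqVneq k 0; first by rewrite add0r.
have [->|l0] := eqVneq l 0; first by rewrite addr0.
case: s rs => [|[d m] s].
  by move=> _; rewrite /lmul_syllable /= (negPf k0) (negPf l0) /= eqxx.
rewrite reduced_word_cons /lmul_syllable /= (negPf k0) (negPf l0).
move=> /and3P[m0 ds _]; have [td|ntd] := eqVneq t d; last first.
  by rewrite /= eqxx.
subst d; have [lm0|lm0] := eqVneq (l + m) 0.
  rewrite -addrA lm0 addr0 (negPf k0).
  have -> : l = - m by apply/eqP; rewrite -addr_eq0 lm0.
  case: s ds => [|[e p] s] /= => [_|/negPf ->]; rewrite subr_eq0.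
    by case: eqVneq => [->|].
  by case: eqVneq => [->|].
rewrite /= eqxx addrA.
by case: (eqVneq (k + l) 0) => // ->; rewrite add0r (negPf m0).
Qed.

Lemma word_mul_reduced u v : reduced_word v -> reduced_word (word_mul u v).
Proof. by move=> rv; elim: u => //= c u; apply: lmul_syllable_reduced. Qed.

Lemma word_mul_lmul c u v : reduced_word u -> reduced_word v ->
  word_mul (lmul_syllable c u) v = lmul_syllable c (word_mul u v).
Proof.
case: c => t k ru rv; have [->|k0] := eqVneq k 0; first by [].
case: u ru => [_|[d m] u ru]; first by rewrite {1}/lmul_syllable (negPf k0).
rewrite {1}/lmul_syllable /= (negPf k0); have [<-|//] := eqVneq t d.
rewrite lmul_syllableD ?word_mul_reduced //.
by have [->|km0] := eqVneq (k + m) 0.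
Qed.

Lemma word_mulA u v w : reduced_word v -> reduced_word w ->
  word_mul u (word_mul v w) = word_mul (word_mul u v) w.
Proof.
move=> rv rw; elim: u => //= c u ->.
by rewrite word_mul_lmul ?word_mul_reduced.
Qed.

Lemma word_mul1 u : reduced_word u -> word_mul u [::] = u.
Proof.
elim: u => //= c u IH rcu; move: (rcu).
by rewrite reduced_word_cons => /and3P[_ _ /IH ->]; apply: lmul_syllable_cons.
Qed.

Lemma word_inv_reduced u : reduced_word u -> reduced_word (word_inv u).
Proof.
move=> /andP[nz alt]; apply/andP; split.
  by rewrite all_rev all_map; apply: sub_all nz => c /=; rewrite oppr_eq0.
rewrite rev_sorted sorted_map; apply: sub_sorted alt => c d /=.
by rewrite eq_sym.
Qed.

Lemma word_invK : involutive word_inv.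
Proof.
move=> u; rewrite /word_inv map_rev revK -map_comp -[RHS]map_id.
by apply: eq_map => -[t k] /=; rewrite opprK.
Qed.

Lemma word_mulV u : reduced_word u -> word_mul (word_inv u) u = [::].
Proof.
elim: u => //= -[t k] u IH rcu.
rewrite /word_inv /= rev_cons /word_mul foldr_rcons -(lmul_syllable_cons rcu).
move: rcu; rewrite reduced_word_cons => /and3P[_ _ ru].
by rewrite lmul_syllableD // addNr; apply: IH.
Qed.

Definition freeZZ_one : freeZZ := FreeZZ (isT : reduced_word [::]).
Definition freeZZ_mul (u v : freeZZ) : freeZZ :=
  FreeZZ (word_mul_reduced u (valP v)).
Definition freeZZ_inv (u : freeZZ) : freeZZ :=
  FreeZZ (word_inv_reduced (valP u)).

Fact freeZZ_mulA : associative freeZZ_mul.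
Proof. by move=> u v w; apply/val_inj/word_mulA; apply: valP. Qed.

Fact freeZZ_mul1g : left_id freeZZ_one freeZZ_mul.
Proof. by move=> u; apply: val_inj. Qed.

Fact freeZZ_mulg1 : right_id freeZZ_one freeZZ_mul.
Proof. by move=> u; apply/val_inj/word_mul1/valP. Qed.

Fact freeZZ_mulVg : left_inverse freeZZ_one freeZZ_inv freeZZ_mul.
Proof. by move=> u; apply/val_inj/word_mulV/valP. Qed.

Fact freeZZ_mulgV : right_inverse freeZZ_one freeZZ_inv freeZZ_mul.
Proof.
move=> u; apply: val_inj; rewrite /= -{1}[val u]word_invK.
exact/word_mulV/word_inv_reduced/valP.
Qed.

HB.instance Definition _ := isGroup.Build freeZZ
  freeZZ_mulA freeZZ_mul1g freeZZ_mulg1 freeZZ_mulVg freeZZ_mulgV.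

Definition freeZZ_a : freeZZ := FreeZZ (isT : reduced_word [:: (false, 1)]).
Definition freeZZ_b : freeZZ := FreeZZ (isT : reduced_word [:: (true, 1)]).

Definition expgz (G : groupType) (g : G) (k : int) : G :=
  match k with Posz m => (g ^+ m)%g | Negz m => (g ^- m.+1)%g end.

(* w = a^(x_1) b^(y_1) ... a^(x_n) b^(y_n) with nonzero exponents and trivial
   exponent sums; n, x and y are determined by w. *)
Definition word_exponents (w : freeZZ) (n : nat) (x y : 'I_n -> int) : Prop :=
  [/\ w = (\prod_(i < n) (expgz freeZZ_a (x i) * expgz freeZZ_b (y i)))%g,
      forall i, x i != 0 /\ y i != 0,
      \sum_(i < n) x i = 0 & \sum_(i < n) y i = 0].

Definition alternating (w : freeZZ) : Prop :=
  exists (n : nat) (x y : 'I_n -> int), word_exponents w x y /\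
    forall i, (x i = 1 \/ x i = -1) /\ (y i = 1 \/ y i = -1).

Definition flow_polyhedron_of_word (R : realType) (w : freeZZ) (n : nat)
    (P : set 'M[R]_n) : Prop :=
  exists x y : 'I_n -> int, word_exponents w x y /\
    (P = flow_polyhedron x \/ P = flow_polyhedron y).

(* Main.v *)
Require Import Defs.
From HB Require Import structures.
From mathcomp Require Import all_boot all_order all_algebra.
From mathcomp Require Import boolp classical_sets reals.
From mathcomp Require Import zify ring.

(** Two independent ideas meet here: an arbitrary integer weighting of the
    edges of G can be produced by vertices of weight 1 and -1, and a suitable
    weighting singles out one circulation.

    Vertices. Subdividing an edge of G adds vertices of weight 1 or -1 on it,
    and every circulation runs through all pieces of a subdivided edge with the
    same value. Hence the condition that the weighted sum of the outflows
    vanishes reads [\sum_e c e * f e = 0] for the circulation f that is induced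
    on G, where c e is the weight of the source of e plus that of the vertices
    added on e. All integer weights c occur ([realizable_all]), even if each
    edge is divided, so that the subdivision H has no parallel edges and embeds
    into a complete digraph with loops. A second copy of its vertices, with
    opposite weights and left out of the support, makes the weights sum to 0.

    Weights. G carries a positive circulation d that is 1 on some edge e0: as
    long as d is at least 2 everywhere, a cycle can be subtracted
    ([unit_circulation]). Give the edges other than e0 distinct powers of a
    large base N as weights, and correct the weight of e0 so that d gets weight
    0. A nonnegative integral f of weight 0 then satisfies
    [\sum_e N ^ i e * f e = f e0 * \sum_e N ^ i e * d e]; so f vanishes if
    f e0 = 0, and if f e0 = 1 and f is small then f = d because expansions in
    base N are unique. A positive linear functional with a large coefficient at
    e0 is therefore minimal at d, and only there ([separating_weights]).

    Extremality. Extended by a still larger penalty off the image of H, the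
    functional has only positive coefficients on the matrix entries, and the
    lift of d is its only minimizer among the disk vectors
    ([lifted_flow_minimizer]). It is positive on the nonzero vectors of the flow
    cone, hence the lift of d is also its only minimizer on the polyhedron and
    so an extremal point ([flow_polyhedron_extremal]). The support of this
    point is a copy of H, a subdivision of G. *)

Set Implicit Arguments.
Unset Strict Implicit.
Unset Printing Implicit Defensive.

Import Order.TTheory GRing.Theory Num.Theory.
Local Open Scope classical_set_scope.
Local Open Scope ring_scope.

(** * Circulations with a unit edge *)

Definition circulation (U : nmodType) (G : mdgraph) (f : md_edge G -> U) :=
  forall v, \sum_(e | md_tgt e == v) f e = \sum_(e | md_src e == v) f e.

(** The same identity with [addn], the form in which linear arithmetic on
    natural numbers applies. *)
Lemma circulation_natE (G : mdgraph) (f : md_edge G -> nat) :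
  circulation f <-> forall v, (\sum_(e | md_tgt e == v) f e =
                               \sum_(e | md_src e == v) f e)%N.
Proof. by []. Qed.

Lemma sum_delta (I : finType) (P : pred I) (i : I) :
  \sum_(j | P j) (j == i : nat) = P i :> nat.
Proof.
case: (boolP (P i)) => Pi; last first.
  by rewrite big1 // => j Pj; case: eqP => // ji; rewrite ji (negPf Pi) in Pj.
by rewrite (bigD1 i) //= eqxx big1 ?addn0 // => j /andP[_ /negPf ->].
Qed.

(** The unit flow along a path. The path visits no vertex twice, so each edge is
    used at most once and no edge leaves the last vertex; the second clause
    keeps the induction going and lets the path be closed into a cycle. *)
Lemma path_flow (G : mdgraph) (p : seq (md_vertex G)) (u : md_vertex G) :
  path (@md_adj G) u p -> uniq (u :: p) ->
  exists g : md_edge G -> nat,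
    [/\ forall e, (g e <= 1)%N,
        forall e, (0 < g e)%N -> md_src e \in belast u p
      & forall v, (\sum_(e | md_src e == v) g e + (v == last u p) =
                   \sum_(e | md_tgt e == v) g e + (v == u))%N].
Proof.
elim: p u => [|v p IH] u /=.
  by move=> _ _; exists (fun=> 0%N); split=> // v; rewrite !big1.
move=> /andP[/existsP[e /andP[/eqP se /eqP te]] vp] /andP[uNp up].
have [g [g1 gsupp gbal]] := IH v vp up.
exists (fun x => g x + (x == e))%N; split=> [x|x|w].
- case: eqVneq => [->|_]; last by rewrite addn0.
  rewrite addn1 ltnS leqNgt; apply: contra uNp => /gsupp.
  by rewrite se => /mem_belast.
- case: eqVneq => [->|_]; first by rewrite se mem_head.
  by rewrite addn0 inE => /gsupp ->; rewrite orbT.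
rewrite !big_split /= !sum_delta se te.
by have := gbal w; rewrite [u == w]eq_sym [v == w]eq_sym; lia.
Qed.

Lemma simple_cycle (G : mdgraph) (e : md_edge G) : md_connected G ->
  exists g : md_edge G -> nat,
    [/\ g e = 1%N, forall x, (g x <= 1)%N & circulation g].
Proof.
move=> cG; have /connectP[p0 pp0 pe0] := cG (md_tgt e) (md_src e).
move: pe0; case/shortenP: pp0 => p pp up _ pe.
have [g [g1 gsupp gbal]] := path_flow pp up.
have ge0 : g e = 0%N.
  apply/eqP; rewrite -leqn0 leqNgt; apply/negP => /gsupp; rewrite pe.
  by move: up; rewrite lastI rcons_uniq => /andP[/negPf ->].
exists (fun x => g x + (x == e))%N; split=> [|x|v].
- by rewrite eqxx ge0.
- by case: eqVneq => [->|_]; rewrite ?ge0 ?addn0.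
move: v; apply/circulation_natE => v.
rewrite !big_split /= !sum_delta; have := gbal v; rewrite -pe.
by rewrite [md_src e == v]eq_sym [md_tgt e == v]eq_sym; lia.
Qed.

Lemma positive_circulation (G : mdgraph) : md_connected G ->
  exists d : md_edge G -> nat, (forall e, 0 < d e)%N /\ circulation d.
Proof.
move=> cG; have /fin_all_exists[g gP] := fun e => simple_cycle e cG.
exists (fun x => \sum_e g e x)%N; split=> [e|v].
  by rewrite (bigD1 e) //=; have [-> _ _] := gP e.
rewrite exchange_big [RHS]exchange_big; apply: eq_bigr => e _.
by have [_ _ ->] := gP e.
Qed.

(** Descent on the total value: a circulation with all values at least 2 stays
    positive when a cycle, which has values at most 1, is subtracted. *)
Lemma unit_circulation (G : mdgraph) : md_connected G -> md_nonempty G ->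
  exists (d : md_edge G -> nat) (e0 : md_edge G),
    [/\ forall e, (0 < d e)%N, circulation d & d e0 = 1%N].
Proof.
move=> cG /card_gt0P[e1 _]; have [d [d0 dc]] := positive_circulation cG.
have [m] := ubnP (\sum_e d e)%N; elim: m d d0 dc => // m IH d d0 dc dm.
have [e /eqP de|dN1] := pickP (fun e => d e == 1%N).
  by exists d, e.
have [g [ge g1 gc]] := simple_cycle e1 cG.
have gd e : (g e < d e)%N.
  have := d0 e; have := g1 e; have := dN1 e => /=; lia.
have dE P : (\sum_(e | P e) (d e - g e) + \sum_(e | P e) g e =
             \sum_(e | P e) d e)%N.
  by rewrite -big_split; apply: eq_bigr => e _; rewrite /= subnK // ltnW.
apply: (IH (fun e => d e - g e)%N) => [e|v|].
- by rewrite subn_gt0.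
- move: v; apply/circulation_natE => v; have := proj1 (circulation_natE d) dc v.
  by rewrite -!dE; have := proj1 (circulation_natE g) gc v; lia.
- have : (g e1 <= \sum_e g e)%N by rewrite (bigD1 e1) //= leq_addr.
  by have /= := dE xpredT; rewrite ge; lia.
Qed.

(** * Weights that isolate a circulation *)

(** Induction on the length, as digit 0 is the residue of the sum modulo N. *)
Lemma digits_inj (N n : nat) (f g : nat -> nat) :
  (forall i, i < n -> f i < N)%N -> (forall i, i < n -> g i < N)%N ->
  (\sum_(i < n) N ^ i * f i = \sum_(i < n) N ^ i * g i)%N ->
  forall i, (i < n)%N -> f i = g i.
Proof.
elim: n f g => // n IH f g fN gN; rewrite !big_ord_recl /= !expn0 !mul1n.
have shift (h : nat -> nat) : (\sum_(i < n) N ^ bump 0 i * h (bump 0 i) =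
    (\sum_(i < n) N ^ i * h i.+1) * N)%N.
  by rewrite big_distrl; apply: eq_bigr => i _ /=; rewrite expnS -mulnA mulnC.
rewrite !shift => E; have N0 : (0 < N)%N by apply: leq_trans (fN 0%N _).
have E0 : f 0%N = g 0%N.
  have := congr1 (modn^~ N) E.
  by rewrite /= ![(_ + _ * N)%N]addnC !modnMDl !modn_small ?fN ?gN.
move: E; rewrite E0 => /addnI /eqP; rewrite eqn_pmul2r // => /eqP E.
case=> // i; rewrite ltnS => lin; apply: (IH (f \o succn) (g \o succn)) => //.
- by move=> j jn; apply: fN.
- by move=> j jn; apply: gN.
Qed.

(** With D the sum of d and N = D + 1, the edge e gets the weight [N ^ i e],
    where i enumerates E, and e0 gets in addition [- \sum_e N ^ i e * d e]. In
    phi the coefficient at e0 is D + 1 and all others are 1. Since phi takes the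
    value 2 D at d, the bound forces f e0 <= 1; the value 0 would make f vanish,
    and for the value 1 the entries of f and d are base N digits of one
    number. *)
Lemma separating_weights (E : finType) (d : E -> nat) (e0 : E) :
  d e0 = 1%N -> exists (c : E -> int) (phi : E -> nat),
  [/\ \sum_e c e * (d e)%:Z = 0, forall e, (0 < phi e)%N &
      forall f : E -> nat, (exists e, f e != 0%N) ->
        \sum_e c e * (f e)%:Z = 0 ->
        (\sum_e phi e * f e <= \sum_e phi e * d e)%N -> f =1 d].
Proof.
move=> de0; pose D := (\sum_e d e)%N.
pose W (f : E -> nat) := (\sum_e D.+1 ^ enum_rank e * f e)%N.
pose c (e : E) : int := (D.+1 ^ enum_rank e)%:Z - (W d * (e == e0))%N%:Z.
pose phi (e : E) := (1 + D * (e == e0))%N.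
have sel (k : nat) (f : E -> nat) : (\sum_e k * (e == e0) * f e = k * f e0)%N.
  rewrite (bigD1 e0) //= eqxx muln1 big1 ?addn0 // => e /negPf ->.
  by rewrite muln0.
have cE f : \sum_e c e * (f e)%:Z = (W f)%:Z - (W d * f e0)%N%:Z.
  rewrite -(sel (W d)) {1}/W -!natz !natr_sum -sumrB.
  by apply: eq_bigr => e _; rewrite /c mulrBl -!natz !natrM !natz.
have phiE (f : E -> nat) : (\sum_e phi e * f e = \sum_e f e + D * f e0)%N.
  rewrite -(sel D) -big_split; apply: eq_bigr => e _.
  by rewrite /= mulnDl mul1n.
exists c, phi; split=> // [|f [e1 fe1]]; first by rewrite cE de0 muln1 subrr.
rewrite cE !phiE de0 => /eqP; rewrite subr_eq0 => /eqP[Wf] le_phi.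
have f1 : (f e1 <= \sum_e f e)%N by rewrite (bigD1 e1) //= leq_addr.
have fe0 : f e0 = 1%N.
  have : (f e0 <= 1)%N.
    rewrite leqNgt; apply/negP => /(leq_mul (leqnn D)).
    by move: fe1 f1 le_phi; rewrite -/D; lia.
  have : f e0 != 0%N; last by lia.
  apply: contra fe1 => /eqP fe0; move/eqP: Wf; rewrite fe0 muln0.
  rewrite sum_nat_eq0 => /forallP/(_ e1).
  by rewrite muln_eq0 expn_eq0.
have fD : (\sum_e f e <= D)%N by move: le_phi; rewrite fe0 -/D; lia.
have lt_sum (h : E -> nat) : (\sum_e h e <= D)%N ->
    forall e, (h e < D.+1)%N.
  move=> hD e; rewrite ltnS; apply: leq_trans hD.
  by rewrite (bigD1 e) //= leq_addr.
(* The digit at a position that enumerates no edge is irrelevant; 0 is used. *)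
pose dig (h : E -> nat) i :=
  if insub i is Some j then h (@enum_val E E j) else 0%N.
have digE (h : E -> nat) (i : 'I_#|E|) : dig h i = h (enum_val i).
  by rewrite /dig valK.
have WE (h : E -> nat) : W h = (\sum_(i < #|E|) D.+1 ^ i * dig h i)%N.
  rewrite /W (reindex (@enum_val E E)) /=; last first.
    by apply: onW_bij; apply: enum_val_bij.
  by apply: eq_bigr => i _; rewrite enum_valK digE.
have dig_lt (h : E -> nat) : (\sum_e h e <= D)%N ->
    forall i, (i < #|E|)%N -> (dig h i < D.+1)%N.
  by move=> hD i iE; rewrite (digE h (Ordinal iE)) lt_sum.
move=> e; rewrite -[e]enum_rankK -!digE.
apply: (@digits_inj D.+1 #|E|) => //; try exact: dig_lt.
by rewrite -!WE Wf fe0 muln1.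
Qed.

(** * Subdivisions realizing given edge weights *)

(** H is a subdivision of G with vertex weights s, and p sends an edge of H to
    the edge of G of which it is a piece. The weights s induce on G the edge
    weights c. Edges outside L are not yet divided, and these alone can be
    parallel to another edge of H. *)
Record weighted_subdivision (R : pzRingType) (G H : mdgraph)
    (c : md_edge G -> int) (L : {set md_edge G})
    (p : md_edge H -> md_edge G) (s : md_vertex H -> int) : Prop := {
  wsub_equiv : md_equiv G H;
  wsub_connected : md_connected H;
  wsub_surj : forall e, exists d, p d = e;
  wsub_sign : forall v, s v = 1 \/ s v = -1;
  wsub_circ : forall f : md_edge G -> R, circulation f -> circulation (f \o p);
  wsub_const : forall F : md_edge H -> R, circulation F ->
    forall d1 d2, p d1 = p d2 -> F d1 = F d2;
  wsub_weight : forall f : md_edge G -> R,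
    \sum_d (s (md_src d))%:~R * f (p d) = \sum_e (c e)%:~R * f e;
  wsub_undivided : forall d1 d2, p d1 = p d2 -> d1 = d2 \/ p d1 \in L;
  wsub_simple : forall d1 d2, md_src d1 = md_src d2 -> md_tgt d1 = md_tgt d2 ->
    d1 = d2 \/ p d1 \notin L }.

Lemma subdivide_connected (G : mdgraph) (e : md_edge G) :
  md_connected G -> md_connected (md_subdivide e).
Proof.
move=> cG; set H := md_subdivide e.
have adj (d : md_edge H) : connect (@md_adj H) (md_src d) (md_tgt d).
  by apply/connect1/existsP; exists d; rewrite !eqxx.
have old u v : connect (@md_adj H) (Some u) (Some v).
  have /connectP[q pq ->] := cG u v; elim: q u pq => //= w q IH u /andP[].
  move=> /existsP[d /andP[/eqP <- /eqP <-]] /IH; apply: connect_trans.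
  have := adj (Some d) => /=; have [->|//] := eqVneq d e.
  by move/connect_trans; apply; apply: (adj None).
have into : connect (@md_adj H) (Some (md_src e)) None.
  by have := adj (Some e); rewrite /= eqxx.
have out : connect (@md_adj H) None (Some (md_tgt e)) by exact: (adj None).
case=> [u|] [v|] //; first exact: connect_trans (old _ _) into.
exact: connect_trans out (old _ _).
Qed.

Lemma big_option (U : nmodType) (I : finType) (P : pred (option I))
    (F : option I -> U) :
  \sum_(d | P d) F d =
  (if P None then F None else 0) + \sum_(d | P (Some d)) F (Some d).
Proof.
rewrite ![index_enum _]unlock [@Finite.enum in LHS]unlock /= big_cons big_map.
by case: ifP; rewrite ?add0r.
Qed.

(** Conservation at the new vertex [None] says that the two halves of e carry
    the same value; at the old vertices nothing changes. *)
Lemma subdivide_circulation (U : nmodType) (G : mdgraph) (e : md_edge G)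
    (F : md_edge (md_subdivide e) -> U) :
  circulation F <->
  F None = F (Some e) /\ circulation (G := G) (fun d => F (Some d)).
Proof.
pose f d := F (Some d).
have outN : \sum_(d : md_edge (md_subdivide e) | md_src d == None) F d = F None.
  by rewrite big_option /= big_pred0 ?addr0.
have inN : \sum_(d : md_edge (md_subdivide e) | md_tgt d == None) F d = f e.
  rewrite big_option /= add0r (eq_bigl (pred1 e)) ?big_pred1_eq // => d /=.
  by case: (eqVneq d e).
have outS v : \sum_(d : md_edge (md_subdivide e) | md_src d == Some v) F d =
    \sum_(d | md_src d == v) f d.
  by rewrite big_option /= add0r.
have inS v : F None = f e ->
    \sum_(d : md_edge (md_subdivide e) | md_tgt d == Some v) F d =
    \sum_(d | md_tgt d == v) f d.
  move=> Fe; rewrite big_option /= Fe.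
  have [te|te] := boolP (md_tgt e == v).
    rewrite (_ : (Some _ == _) = true) // [RHS](bigD1 e) //=; congr (_ + _).
    apply: eq_bigl => d.
    by case: (eqVneq d e) => [->|_] /=; rewrite ?andbF ?andbT.
  rewrite (_ : (Some _ == _) = false) ?add0r; last exact: negbTE.
  by apply: eq_bigl => d; case: (eqVneq d e) => //= ->; rewrite (negbTE te).
split=> [cF|[Fe cf] [v|]].
- have Fe : F None = f e by rewrite -inN -outN; apply/esym/cF.
  by split=> // v; rewrite -inS // -outS; apply: cF.
- by rewrite inS // outS; apply: cf.
- by rewrite inN outN.
Qed.

(** The new vertex lies on a piece of [p e], hence its outflow is f (p e), and
    its weight sigma is added to the induced weight of [p e]. The halves of e
    are parallel to no other edge since the new vertex separates them from the
    old edges and from each other. *)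
Lemma weighted_subdivision_step (R : pzRingType) (G H : mdgraph)
    (c : md_edge G -> int) L (p : md_edge H -> md_edge G) s
    (e : md_edge H) (sigma : int) :
  sigma = 1 \/ sigma = -1 -> weighted_subdivision R c L p s ->
  weighted_subdivision R (fun x => c x + sigma * (x == p e)%:Z) (p e |: L)
    (H := md_subdivide e) (fun d => if d is Some d' then p d' else p e)
    (fun v => if v is Some v' then s v' else sigma).
Proof.
move=> sg [GH cH psurj ssg pcirc pconst sweight und simp]; split.
- exact: md_equiv_trans GH (md_equiv_subdivide e).
- exact: subdivide_connected.
- by move=> x; have [d <-] := psurj x; exists (Some d).
- by case.
- by move=> f cf; apply/subdivide_circulation; split=> //; apply: pcirc.
- move=> F /subdivide_circulation[Fe cF] d1 d2 p12.
  have FE (d : md_edge (md_subdivide e)) : F d = F (Some (odflt e d)).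
    by case: d.
  by rewrite FE [RHS]FE; apply: (pconst _ cF); case: d1 d2 p12 => [?|] [?|].
- move=> f; rewrite big_option /= sweight [RHS](eq_bigr (fun x =>
      (c x)%:~R * f x + (sigma * (x == p e)%:Z)%:~R * f x)); last first.
    by move=> x _; rewrite rmorphD mulrDl.
  rewrite big_split addrC /=; congr (_ + _); rewrite (bigD1 (p e)) //=.
  rewrite eqxx mulr1 big1 ?addr0 // => x /negPf ->.
  by rewrite mulr0 mul0r.
- case=> [d1|] [d2|] /= E; last 3 first.
  - by right; rewrite !inE E eqxx.
  - by right; rewrite !inE eqxx.
  - by left.
  have [->|pL] := und _ _ E; first by left.
  by right; rewrite !inE pL orbT.
- case=> [d1|] [d2|] //= => [[sE]|_ _]; last by left.
  case: (eqVneq d1 e) => [->|d1e]; case: (eqVneq d2 e) => [->|d2e] //.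
    by left.
  move=> [tE].
  have [->|pL] := simp _ _ sE tE; first by left.
  right; rewrite !inE (negPf pL) orbF; apply/eqP => /und[d1E|].
    by rewrite d1E eqxx in d1e.
  by rewrite (negPf pL).
Qed.

Definition realizable (R : pzRingType) (G : mdgraph) (c : md_edge G -> int) L :=
  exists (H : mdgraph) (p : md_edge H -> md_edge G) (s : md_vertex H -> int),
    weighted_subdivision R c L p s.

Section Realizable.
Variables (R : pzRingType) (G : mdgraph).
Implicit Types (c : md_edge G -> int) (L : {set md_edge G}).

Lemma eq_realizable c c' L : c =1 c' -> realizable R c L -> realizable R c' L.
Proof.
move=> cc' [H [p [s [? ? ? ? ? ? sweight ? ?]]]]; exists H, p, s; split=> // f.
by rewrite sweight; apply: eq_bigr => e _; rewrite cc'.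
Qed.

Lemma realizable_one : md_connected G ->
  realizable R (fun=> 1) (finset.set0 : {set md_edge G}).
Proof.
move=> cG; exists G, id, (fun=> 1); split=> //.
- by apply: md_equiv_iso; exists id, id; split=> //; exists id.
- by move=> e; exists e.
- by move=> v; left.
- by move=> F _ d1 d2 ->.
- by move=> d1 d2; left.
- by move=> d1 d2 _ _; right; rewrite inE.
Qed.

Lemma realizable_add_sign c L e sigma m : sigma = 1 \/ sigma = -1 ->
  realizable R c L ->
  realizable R (fun x => c x + (sigma * m.+1%:Z) * (x == e)%:Z) (e |: L).
Proof.
move=> sg; have step c' L' : realizable R c' L' ->
    realizable R (fun x => c' x + sigma * (x == e)%:Z) (e |: L').
  move=> [H [p [s W]]]; have [d <-] := wsub_surj W e.
  by do 3!eexists; apply: weighted_subdivision_step W.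
move=> rc; elim: m => [|m /step]; last rewrite finset.setUA finset.setUid.
  by rewrite mulr1; apply: step.
by apply: eq_realizable => x; rewrite -[m.+2]addn1 PoszD; ring.
Qed.

(** Overshooting by the absolute value of k before correcting with the opposite
    sign divides e even when k is 0. *)
Lemma realizable_add c L e (k : int) : realizable R c L ->
  realizable R (fun x => c x + k * (x == e)%:Z) (e |: L).
Proof.
move=> /(realizable_add_sign e `|k|%N (or_introl erefl)).
move=> /(realizable_add_sign e (absz (`|k|%:Z - k)) (or_intror erefl)).
rewrite finset.setUA finset.setUid; apply: eq_realizable => x.
by rewrite -addrA -mulrDl; congr (_ + _ * _); lia.
Qed.

(** Starting from G itself, where each edge has the weight 1 of its source, the
    weights are corrected edge by edge. *)
Lemma realizable_all c : md_connected G -> realizable R c finset.setT.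
Proof.
move=> cG.
have seqP (r : seq (md_edge G)) : 
    realizable R (fun x => if x \in r then c x else 1) [set x in r].
  elim: r => [|e r IH].
    rewrite (_ : [set x in [::]] = finset.set0); first exact: realizable_one.
    by apply/finset.setP => x; rewrite !inE.
  have := realizable_add e (c e - (if e \in r then c e else 1)) IH.
  rewrite (_ : e |: _ = [set x in e :: r]); last first.
    by apply/finset.setP => x; rewrite !inE.
  apply: eq_realizable => x; rewrite inE; case: eqVneq => [->|_] /=; lia.
have := seqP (enum (md_edge G)).
rewrite (_ : [set x in _] = finset.setT); last first.
  by apply/finset.setP => x; rewrite !inE mem_enum.
by apply: eq_realizable => x; rewrite mem_enum.
Qed.

End Realizable.

(** * Extremal points as unique minimizers *)

Section UniqueMinimizer.
Variables (R : realType) (V : lmodType R) (Phi : {scalar V}).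
Implicit Types (S : set V) (d : V).

Definition unique_minimizer S d := forall v, S v -> Phi v <= Phi d -> v = d.

(** The nonnegative gaps [Phi (v i) - Phi d] have a weighted mean that is at
    most 0, so each gap with a nonzero weight vanishes. *)
Lemma unique_minimizer_convex S d : unique_minimizer S d ->
  forall k (l : 'I_k -> R) (v : 'I_k -> V),
    (forall i, 0 <= l i) -> \sum_(i < k) l i = 1 -> (forall i, S (v i)) ->
    Phi (\sum_(i < k) l i *: v i) <= Phi d -> forall i, l i = 0 \/ v i = d.
Proof.
move=> min k l v l0 l1 Sv le_d i.
have gap0 j : 0 <= l j * (Phi (v j) - Phi d).
  rewrite mulr_ge0 // subr_ge0 leNgt; apply/negP => lt_d.
  by have := lt_d; rewrite (min _ (Sv j) (ltW lt_d)) ltxx.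
have gap_sum : \sum_j l j * (Phi (v j) - Phi d) <= 0.
  under eq_bigr => j _ do rewrite mulrBr.
  rewrite sumrB -mulr_suml l1 mul1r subr_le0; apply: le_trans le_d.
  by rewrite linear_sum; under [leRHS]eq_bigr => j _ do rewrite linearZ.
have gap_eq0 : \sum_j l j * (Phi (v j) - Phi d) = 0.
  by apply: le_anti; rewrite gap_sum sumr_ge0.
have /eqP := psumr_eq0P (fun j _ => gap0 j) gap_eq0 (i := i) isT.
rewrite mulf_eq0 subr_eq0 => /orP[/eqP|/eqP li]; first by left.
by right; apply: min; rewrite ?li.
Qed.

Lemma unique_minimizer_hull S d :
  unique_minimizer S d -> unique_minimizer (convex_hull S) d.
Proof.
move=> min _ [k [l [v [l0 l1 Sv ->]]]] le_d.
have vd i : l i *: v i = l i *: d.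
  have [->|->//] := unique_minimizer_convex min l0 l1 Sv le_d i.
  by rewrite !scale0r.
by rewrite (eq_bigr _ (fun i _ => vd i)) -scaler_suml l1 scale1r.
Qed.

Lemma unique_minimizer_extremal S d :
  S d -> unique_minimizer S d -> extremal_point S d.
Proof.
move=> Sd min; split=> // k l v l0 l1 Sv dE i.
have le_d : Phi (\sum_(i < k) l i *: v i) <= Phi d by rewrite -dE.
have [li|//] := unique_minimizer_convex min (fun j => ltW (l0 j)) l1 Sv le_d i.
by have := l0 i; rewrite li ltxx.
Qed.

Lemma subset_convex_hull S : S `<=` convex_hull S.
Proof.
move=> v Sv; exists 1%N, (fun=> 1), (fun=> v).
by rewrite !big_ord1 scale1r; split.
Qed.

End UniqueMinimizer.

Section MxDot.
Variables (R : realType) (n : nat).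
Implicit Types A x : 'M[R]_n.

Definition mxdot A x : R := \sum_i \sum_j A i j * x i j.

Lemma mxdot_is_linear A : linear_for *%R (mxdot A).
Proof.
move=> a x y; rewrite /mxdot mulr_sumr -big_split; apply: eq_bigr => i _ /=.
rewrite mulr_sumr -big_split; apply: eq_bigr => j _ /=.
by rewrite !mxE mulrDr mulrCA.
Qed.

HB.instance Definition _ A :=
  GRing.isLinear.Build R 'M[R]_n R *%R (mxdot A) (mxdot_is_linear A).

Lemma mxdot_ge_entry A x i j :
  (forall i j, 0 <= A i j) -> (forall i j, 0 <= x i j) ->
  A i j * x i j <= mxdot A x.
Proof.
move=> A0 x0; rewrite /mxdot (bigD1 i) //= (bigD1 j) //= -addrA lerDl.
rewrite addr_ge0 ?sumr_ge0 // => *; last rewrite sumr_ge0 // => *.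
  by rewrite mulr_ge0.
by rewrite mulr_ge0.
Qed.

(** Positivity of A makes the functional nonnegative on the flow cone and zero
    only at 0, so the cone summand of a minimizer has to vanish. *)
Lemma flow_polyhedron_extremal (z : 'I_n -> int) A d :
  (forall i j, 0 < A i j) -> disk_vectors z d ->
  unique_minimizer (mxdot A) (disk_vectors z) d ->
  extremal_point (flow_polyhedron z) d.
Proof.
move=> A0 Dd min; have A0' i j := ltW (A0 i j).
apply: (@unique_minimizer_extremal _ _ (mxdot A)).
  apply: subset_convex_hull; exists d => //; exists 0; last exact: addr0.
  split; first split=> [i j|i]; first by rewrite mxE.
    by apply: eq_bigr => j _; rewrite !mxE.
  rewrite big1 // => j _.
  by rewrite /outflow big1 ?mulr0 // => k _; rewrite mxE.
apply: unique_minimizer_hull => _ [x Dx [w [[w0 _] _] <-]].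
have w_ge i j := mxdot_ge_entry i j A0' w0.
have Phiw : 0 <= mxdot A w.
  by rewrite sumr_ge0 // => i _; rewrite sumr_ge0 // => j _; rewrite mulr_ge0.
rewrite linearD /= => le_d; have xd : x = d.
  by apply: min => //; apply: le_trans le_d; rewrite lerDl.
rewrite xd in le_d *; rewrite (_ : w = 0) ?addr0 //.
have Phiw0 : mxdot A w <= 0 by rewrite -(lerD2l (mxdot A d)) addr0.
apply/matrixP => i j; rewrite mxE; apply: le_anti; rewrite w0 andbT.
by rewrite -(pmulr_rle0 _ (A0 i j)); apply: le_trans Phiw0.
Qed.

End MxDot.

(** * Embedding a digraph into the complete digraph *)

Lemma inj_surj_bij (A : choiceType) (B : eqType) (f : A -> B) :
  injective f -> (forall b, exists a, f a = b) -> bijective f.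
Proof.
move=> f_inj f_surj.
have ex b : exists a, f a == b by have [a <-] := f_surj b; exists a.
exists (fun b => xchoose (ex b)) => [a|b]; last exact/eqP/(xchooseP (ex b)).
exact/f_inj/eqP/(xchooseP (ex (f a))).
Qed.

Lemma connected_out_edge (G : mdgraph) : md_connected G -> md_nonempty G ->
  forall v : md_vertex G, exists e, md_src e = v.
Proof.
move=> cG /card_gt0P[e _] v; have /connectP[[|w q] /=] := cG v (md_src e).
  by move=> _ sE; exists e.
by move=> /andP[/existsP[d /andP[/eqP <- _]] _] _; exists d.
Qed.

Section EdgeMatrix.
Variables (R : realType) (H : mdgraph) (n : nat) (idx : md_vertex H -> 'I_n).
Hypothesis idx_inj : injective idx.
Hypothesis simple : forall d1 d2 : md_edge H,
  md_src d1 = md_src d2 -> md_tgt d1 = md_tgt d2 -> d1 = d2.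
Implicit Type F : md_edge H -> R.

Definition edge_pos (d : md_edge H) := (idx (md_src d), idx (md_tgt d)).

Lemma edge_pos_inj : injective edge_pos.
Proof. by move=> d1 d2 [/idx_inj sE /idx_inj tE]; apply: simple. Qed.

Definition edge_mx F : 'M[R]_n :=
  \matrix_(i, j) \sum_(d | edge_pos d == (i, j)) F d.

Lemma edge_mxE F d : edge_mx F (idx (md_src d)) (idx (md_tgt d)) = F d.
Proof.
by rewrite mxE (big_pred1 d) // => x /=; rewrite (inj_eq edge_pos_inj).
Qed.

Lemma edge_mx_neq0 F i j : edge_mx F i j != 0 -> exists d, edge_pos d = (i, j).
Proof.
rewrite mxE; case: (pickP (fun d => edge_pos d == (i, j))) => [d /eqP <- _|no].
  by exists d.
by rewrite big_pred0 ?eqxx.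
Qed.

Lemma edge_mx_supported (x : 'M[R]_n) :
  (forall i j, x i j != 0 -> exists d, edge_pos d = (i, j)) ->
  x = edge_mx (fun d => x (idx (md_src d)) (idx (md_tgt d))).
Proof.
move=> supp; apply/matrixP => i j; set F := fun d => _.
have [[d [<- <-]]|no] := pselect (exists d, edge_pos d = (i, j)).
  by rewrite edge_mxE.
have zero (y : R) : (y != 0 -> exists d, edge_pos d = (i, j)) -> y = 0.
  by move=> yP; apply/eqP; apply: contrapT => /negP/yP.
by rewrite (zero _ (supp i j)) (zero _ (@edge_mx_neq0 F i j)).
Qed.

Lemma edge_mx_row F i :
  \sum_j edge_mx F i j = \sum_(d | idx (md_src d) == i) F d.
Proof.
rewrite [RHS](partition_big (fun d => idx (md_tgt d)) predT) //=.
by apply: eq_bigr => j _; rewrite mxE; apply: eq_bigl => d; rewrite xpair_eqE.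
Qed.

Lemma edge_mx_col F j :
  \sum_i edge_mx F i j = \sum_(d | idx (md_tgt d) == j) F d.
Proof.
rewrite [RHS](partition_big (fun d => idx (md_src d)) predT) //=.
apply: eq_bigr => i _; rewrite mxE; apply: eq_bigl => d.
by rewrite xpair_eqE andbC.
Qed.

Lemma mxdot_edge_mx A F :
  mxdot A (edge_mx F) = \sum_d A (idx (md_src d)) (idx (md_tgt d)) * F d.
Proof.
rewrite /mxdot pair_big /= [RHS](partition_big edge_pos predT) //=.
apply: eq_bigr => -[i j] _; rewrite mxE mulr_sumr.
by apply: eq_bigr => d /eqP[<- <-].
Qed.

Lemma edge_mx_flow F :
  is_flow (edge_mx F) <-> (forall d, 0 <= F d) /\ circulation F.
Proof.
split=> [[F0 bal]|[F0 bal]].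
  split=> [d|v]; first by rewrite -edge_mxE.
  have := bal (idx v); rewrite edge_mx_row edge_mx_col.
  under eq_bigl => d do rewrite (inj_eq idx_inj).
  by under [X in _ = X]eq_bigl => d do rewrite (inj_eq idx_inj).
split=> [i j|i]; first by rewrite mxE sumr_ge0.
rewrite edge_mx_row edge_mx_col.
have [[v <-]|no] := pselect (exists v, idx v = i).
  under eq_bigl => d do rewrite (inj_eq idx_inj).
  by under [X in _ = X]eq_bigl => d do rewrite (inj_eq idx_inj).
by rewrite !big_pred0 // => d; apply/eqP => dE; apply: no; eexists; apply: dE.
Qed.

Lemma edge_mx_weight (z : 'I_n -> int) F :
  \sum_j (z j)%:~R * outflow (edge_mx F) j =
  \sum_d (z (idx (md_src d)))%:~R * F d.
Proof.
rewrite [RHS](partition_big (fun d => idx (md_src d)) predT) //=.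
apply: eq_bigr => j _; rewrite /outflow edge_mx_row mulr_sumr.
by apply: eq_bigr => d /eqP ->.
Qed.

Lemma flow_support_edge_mx F : (forall d, F d != 0) ->
  (forall v, exists d : md_edge H, md_src d = v) ->
  md_iso H (flow_support (edge_mx F)).
Proof.
move=> F0 out_edge.
have vP v : supp_vertex (edge_mx F) (idx v).
  have [d <-] := out_edge v; apply/existsP; exists (idx (md_tgt d)).
  by rewrite edge_mxE F0.
have eP d : supp_edge (edge_mx F) (edge_pos d) by rewrite /supp_edge edge_mxE.
exists (fun v => exist _ (idx v) (vP v)).
exists (fun d => exist _ (edge_pos d) (eP d)).
split=> [||d|d]; try exact: val_inj.
- apply: inj_surj_bij => [u v [/idx_inj]//|[i iP]].
  have /existsP[j /orP[]/edge_mx_neq0[d [di dj]]] := iP.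
    by exists (md_src d); apply: val_inj.
  by exists (md_tgt d); apply: val_inj.
- apply: inj_surj_bij => [d1 d2 /(congr1 val)/edge_pos_inj//|[[i j] ijP]].
  by have [d dE] := edge_mx_neq0 ijP; exists d; apply: val_inj.
Qed.

End EdgeMatrix.

Lemma md_iso_connected (G H : mdgraph) :
  md_iso G H -> md_connected G -> md_connected H.
Proof.
move=> [fv [fe [[gv fvK gvK] _ src_fe tgt_fe]]] cG u v.
rewrite -[u]gvK -[v]gvK.
have /connectP[q pq ->] := cG (gv u) (gv v); elim: q (gv u) pq => //= w q IH x.
move=> /andP[/existsP[d /andP[/eqP <- /eqP <-]]] /IH; apply: connect_trans.
by apply/connect1/existsP; exists (fe d); rewrite src_fe tgt_fe !eqxx.
Qed.

(** * The lifted flow *)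

Section Realization.
Variables (R : realType) (G H : mdgraph) (c : md_edge G -> int).
Variables (p : md_edge H -> md_edge G) (s : md_vertex H -> int).
Hypothesis W : weighted_subdivision R c finset.setT p s.
Variables (n : nat) (idx : md_vertex H -> 'I_n) (z : 'I_n -> int).
Hypotheses (idx_inj : injective idx) (zE : forall v, z (idx v) = s v).
Variables (d phi : md_edge G -> nat).
Hypotheses (d_pos : forall e, (0 < d e)%N) (d_circ : circulation d).
Hypothesis d_weight : \sum_e c e * (d e)%:Z = 0.
Hypothesis G_nonempty : md_nonempty G.

Let simple d1 d2 :
  md_src d1 = md_src d2 -> md_tgt d1 = md_tgt d2 -> d1 = d2 :> md_edge H.
Proof. by move=> sE tE; have [//|] := wsub_simple W sE tE; rewrite !inE. Qed.

Definition lifted_flow : 'M[R]_n := edge_mx idx (fun h => (d (p h))%:R).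

Lemma realization_nonempty : md_nonempty H.
Proof.
have /card_gt0P[e _] := G_nonempty; have [h _] := wsub_surj W e.
by apply/card_gt0P; exists h.
Qed.

Lemma lifted_flow_support : md_iso H (flow_support lifted_flow).
Proof.
apply: flow_support_edge_mx => // [h|v].
  by rewrite pnatr_eq0 -lt0n.
exact: connected_out_edge (wsub_connected W) realization_nonempty v.
Qed.

Lemma int_weight (f : md_edge G -> nat) :
  \sum_j (z j)%:~R * outflow (edge_mx idx (fun h => (f (p h))%:R)) j =
  (\sum_e c e * (f e)%:Z)%:~R :> R.
Proof.
rewrite edge_mx_weight; under eq_bigr => h _ do rewrite zE.
rewrite (wsub_weight W (fun e => (f e)%:R)) rmorph_sum.
by apply: eq_bigr => e _; rewrite /= rmorphM.
Qed.

Lemma lifted_flow_disk : disk_vectors z lifted_flow.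
Proof.
split; first split.
- apply/edge_mx_flow => //; split=> [h|]; first exact: ler0n.
  apply: (wsub_circ W (f := fun e => (d e)%:R)) => v.
  by rewrite -!natr_sum; congr _%:R; apply: d_circ.
- by rewrite int_weight d_weight.
- have /card_gt0P[h _] := realization_nonempty.
  apply/eqP => /matrixP/(_ (idx (md_src h)) (idx (md_tgt h))).
  by rewrite edge_mxE // mxE => /eqP; rewrite pnatr_eq0 -leqn0 leqNgt d_pos.
- by move=> i j; rewrite mxE rpred_sum // => h _; apply: intr_nat.
- exact: md_iso_connected lifted_flow_support (wsub_connected W).
Qed.

Hypothesis phi_pos : forall e, (0 < phi e)%N.
Hypothesis d_min : forall f : md_edge G -> nat, (exists e, f e != 0%N) ->
  \sum_e c e * (f e)%:Z = 0 ->
  (\sum_e phi e * f e <= \sum_e phi e * d e)%N -> f =1 d.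

Definition fiber_size e := #|[pred h | p h == e]|.

Lemma fiber_size_gt0 e : (0 < fiber_size e)%N.
Proof.
by have [h hE] := wsub_surj W e; apply/card_gt0P; exists h; apply/eqP.
Qed.

Lemma sum_fiber_avg (g : md_edge G -> R) :
  \sum_h g (p h) / (fiber_size (p h))%:R = \sum_e g e.
Proof.
rewrite (partition_big p predT) //=; apply: eq_bigr => e _.
rewrite (eq_bigr (fun=> g e / (fiber_size e)%:R)) => [|h /eqP->//].
rewrite sumr_const -[#|_|]/(fiber_size e) -[LHS]mulr_natr divfK //.
by rewrite pnatr_eq0 -lt0n fiber_size_gt0.
Qed.

(** On the copy of H the coefficient [phi e] is shared equally among the pieces
    of e, so that a lifted flow is measured by phi on G. The coefficient of
    every other entry exceeds the value at the lift of d, which makes integral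
    flows of at most this value vanish there. *)
Definition penalty : 'M[R]_n := \matrix_(i, j)
  if [pick h | edge_pos idx h == (i, j)] is Some h
  then (phi (p h))%:R / (fiber_size (p h))%:R
  else (\sum_e phi e * d e).+1%:R.

Lemma penalty_pos i j : 0 < penalty i j.
Proof.
rewrite mxE; case: pickP => [h _|_]; last by rewrite ltr0n.
by rewrite divr_gt0 // ltr0n // fiber_size_gt0.
Qed.

Lemma penalty_edge_mx (f : md_edge G -> nat) :
  mxdot penalty (edge_mx idx (fun h => (f (p h))%:R)) =
  (\sum_e phi e * f e)%:R.
Proof.
rewrite mxdot_edge_mx natr_sum.
under [RHS]eq_bigr => e _ do rewrite natrM.
rewrite -(sum_fiber_avg (fun e => (phi e)%:R * (f e)%:R)).
apply: eq_bigr => h _; rewrite mulrAC; congr (_ * _); rewrite mxE.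
by case: pickP => [h' /eqP/(edge_pos_inj idx_inj simple) ->|/(_ h)/eqP].
Qed.

(** A disk vector x that does not exceed the value of the lift of d has its
    support in H because of the penalty. It is then the lift of a nonzero
    natural-valued function f on the edges of G of weight 0, and f = d by the
    choice of phi. *)
Lemma lifted_flow_minimizer :
  unique_minimizer (mxdot penalty) (disk_vectors z) lifted_flow.
Proof.
move=> x [[[x0 xbal] xz] xN0 xint _].
rewrite /lifted_flow /= penalty_edge_mx => x_le.
have xnat i j : exists m : nat, x i j = m%:R.
  by apply/natrP; rewrite natrEint xint x0.
have xsupp i j : x i j != 0 -> exists h, edge_pos idx h = (i, j).
  move=> xij; apply: contrapT => off.
  have pen_ge0 i j := ltW (penalty_pos i j).
  have := le_trans (mxdot_ge_entry i j pen_ge0 x0) x_le.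
  rewrite mxE; case: pickP => [h /eqP hE|_]; first by case: off; exists h.
  have [m xm] := xnat i j; move: xij; rewrite xm pnatr_eq0 => m0.
  rewrite -natrM ler_nat; set S := (\sum_e _)%N.
  by case: m m0 {xm} => // m _; rewrite mulSn; lia.
have xE := edge_mx_supported idx_inj simple xsupp.
set F := fun h => _ in xE.
have cF : circulation F.
  by have /edge_mx_flow[] : is_flow (edge_mx idx F) by rewrite -xE.
have Fconst := wsub_const W cF.
(* F is constant on the pieces of an edge, so a choice q of one piece for each
   edge of G shows that F is lifted from G. *)
have /fin_all_exists[q qK] := wsub_surj W.
have /fin_all_exists[f fE] e : exists m : nat, F (q e) = m%:R by apply: xnat.
have Fp h : F h = (f (p h))%:R by rewrite -fE; apply: Fconst; rewrite qK.
have {}xE : x = edge_mx idx (fun h => (f (p h))%:R).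
  by rewrite xE; congr edge_mx; apply: funext.
rewrite xE; suff fd : f =1 d by congr edge_mx; apply: funext => h; rewrite fd.
apply: d_min.
- apply: contrapT => f0; move/eqP: xN0; apply; rewrite xE.
  apply/matrixP => i j; rewrite !mxE big1 // => h _.
  apply/eqP; rewrite pnatr_eq0; apply/negPn/negP => fh.
  by apply: f0; exists (p h).
- by apply/eqP; rewrite -(intr_eq0 R) -int_weight -xE xz.
- by move: x_le; rewrite xE penalty_edge_mx ler_nat.
Qed.

End Realization.

(** * Construction of the word *)

Lemma balanced_word n (z : 'I_n -> int) :
  (forall i, z i = 1 \/ z i = -1) -> \sum_i z i = 0 ->
  exists w : freeZZ, word_exponents w z z /\ alternating w.
Proof.
move=> z1 z0.
exists (\prod_(i < n) (expgz freeZZ_a (z i) * expgz freeZZ_b (z i)))%g.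
have wE : word_exponents
    (\prod_(i < n) (expgz freeZZ_a (z i) * expgz freeZZ_b (z i)))%g z z.
  by split=> // i; have [->|->] := z1 i.
by split=> //; exists n, z, z.
Qed.

Theorem mainTheorem6 (R : realType) (G : mdgraph) :
  md_connected G -> md_nonempty G -> md_abstract G ->
  exists w : freeZZ, alternating w /\
  exists (n : nat) (P : set 'M[R]_n), flow_polyhedron_of_word w P /\
  exists f : 'M[R]_n, extremal_point P f /\
    md_abstract_graph_of (flow_support f) G.
Proof.
move=> cG nG aG; have [d [e0 [d_pos d_circ de0]]] := unit_circulation cG nG.
have [c [phi [d_weight phi_pos d_min]]] := separating_weights de0.
have [H [p [s W]]] := realizable_all R c cG.
(* The second summand only balances the weights; no flow passes through it. *)
pose T : finType := (md_vertex H + md_vertex H)%type.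
pose idx v : 'I_#|T| := enum_rank (inl v : T).
pose zT (t : T) := match t with inl v => s v | inr v => - s v end.
pose z (i : 'I_#|T|) := zT (enum_val i).
have idx_inj : injective idx by move=> u v /enum_rank_inj[].
have zE v : z (idx v) = s v by rewrite /z enum_rankK.
have z_sign i : z i = 1 \/ z i = -1.
  rewrite /z; case: (enum_val i) => v /=; have [->|->] := wsub_sign W v;
    by rewrite ?opprK; auto.
have z_sum : \sum_i z i = 0.
  rewrite -(reindex (@enum_val T T) (P := predT) (F := zT)) /=; last first.
    exact/onW_bij/enum_val_bij.
  by rewrite big_sumType /= sumrN subrr.
have [w [wz alt_w]] := balanced_word z_sign z_sum.
exists w; split=> //; exists #|T|, (flow_polyhedron z); split.
  by exists z, z; split=> //; left.
exists (lifted_flow R p idx d); split.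
  apply: (@flow_polyhedron_extremal _ _ _ (penalty R p idx d phi)).
  - exact: (penalty_pos W).
  - exact: (lifted_flow_disk W).
  - exact: (lifted_flow_minimizer W).
split=> //; apply: md_equiv_trans (md_equiv_sym (wsub_equiv W)).
by apply/md_equiv_sym/md_equiv_iso/(lifted_flow_support W).
Qed.
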